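(* For any $m,q,n\in\mathbb{N}$ with $n\ge q+m-1$ and any sequences of complex numbers $a_{(1);N},\ldots,a_{(m);N}$ defined for integers $N$ in $[q,n+1]$, $$\sum_{q\le N_1<\cdots<N_m\le n+1} a_{(m);N_m}\cdots a_{(1);N_1}=\sum_{k=0}^{m}\left(\prod_{j=0}^{m-k-1}a_{(m-j);\,n+1-j}\right)\left(\sum_{q\le N_1<\cdots<N_k\le n-m+k}a_{(k);N_k}\cdots a_{(1);N_1}\right).$$
   Context: $\mathbb{N}=\{0,1,2,\ldots\}$. Empty products equal $1$. A multiple sum $\sum_{q\le N_1<\cdots<N_k\le M}a_{(k);N_k}\cdots a_{(1);N_1}$ ranges over all strictly increasing $k$-tuples of integers in $[q,M]$. For $k=0$ it equals $1$ whatever its bounds; for $k\ge 1$ it equals $0$ when there are no such tuples. *)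

(* Defs.v *)
From mathcomp Require Import all_boot all_order all_algebra.
From mathcomp Require Import reals.
From mathcomp Require Import complex.

Set Implicit Arguments.
Unset Strict Implicit.
Unset Printing Implicit Defensive.

Import GRing.Theory.

Local Open Scope ring_scope.

(* The sum of a_(k);N_k ... a_(1);N_1 over q <= N_1 < ... < N_k <= M.
   [a l N] is a_(l);N with l counted from 1, whereas [N i] is N_(i+1).
   For k = 0 there is exactly one (empty) tuple, so the sum is 1 for all
   q and M. *)
Definition multisum (C : comNzRingType) (a : nat -> nat -> C)
    (q M k : nat) : C :=
  \sum_(N : {ffun 'I_k -> 'I_M.+1} |
          [forall i : 'I_k, (q <= N i)%N] &&
          [forall i : 'I_k, forall j : 'I_k, (i < j)%N ==> (N i < N j)%N])
    \prod_(i < k) a i.+1 (N i).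

(* Main.v *)
Require Import Defs.
From mathcomp Require Import all_boot all_order all_algebra.
From mathcomp Require Import reals.
From mathcomp Require Import complex.

(** Splitting according to whether the largest index N_m equals n + 1 gives the
    Pascal-type recursion
      S(n + 1, m) = S(n, m) + a_(m);n+1 * S(n, m - 1)
    for m >= 1 and the multiple sums S(M, k) ([multisum_recr]).  The theorem is this
    recursion unrolled along the diagonal: S(n, m) is the term k = m, and
    S(n, m - 1) is again a sum of the original kind with (m, n) replaced by
    (m - 1, n - 1), so that an induction on m supplies the other terms, each
    with its product enlarged by the new factor a_(m);n+1.

    The recursion itself compares sums over functions with different domains
    and codomains.  The codomain is dealt with by describing S(M, k) inside any
    larger range of values ([multisum_widen]), the domain by extending a
    function on 'I_k to 'I_k.+1 by the top value ([extend_top]). *)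

Set Implicit Arguments.
Unset Strict Implicit.
Unset Printing Implicit Defensive.

Import GRing.Theory.

Local Open Scope ring_scope.

Definition increasing_from (q M k : nat) (N : {ffun 'I_k -> 'I_M.+1}) : bool :=
  [forall i : 'I_k, (q <= N i)%N] &&
  [forall i : 'I_k, forall j : 'I_k, (i < j)%N ==> (N i < N j)%N].

Lemma increasing_fromP (q M k : nat) (N : {ffun 'I_k -> 'I_M.+1}) :
  reflect ((forall i, (q <= N i)%N) /\
           (forall i j : 'I_k, (i < j)%N -> (N i < N j)%N))
          (increasing_from q N).
Proof.
apply: (iffP andP) => -[geq inc]; split.
- exact/forallP.
- by move=> i j; move/forallP: inc => /(_ i)/forallP/(_ j)/implyP.
- exact/forallP.
- by apply/forallP => i; apply/forallP => j; apply/implyP; exact: inc.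
Qed.

Lemma increasing_from_le_last (q M k : nat) (N : {ffun 'I_k.+1 -> 'I_M.+1}) i :
  increasing_from q N -> (N i <= N ord_max)%N.
Proof.
case/increasing_fromP=> _ inc; have := leq_ord i.
rewrite leq_eqVlt => /predU1P[eq_i|lt_ik]; last exact/ltnW/inc.
by rewrite (_ : i = ord_max) //; apply: val_inj.
Qed.

Lemma multisum0 (C : comNzRingType) (a : nat -> nat -> C) (q M : nat) :
  multisum a q M 0 = 1.
Proof.
rewrite /multisum (big_pred1 (ffun0 (card_ord 0))) ?big_ord0 // => N /=.
have -> : N = ffun0 (card_ord 0) by apply/ffunP => -[].
by rewrite eqxx; apply/increasing_fromP; split=> -[].
Qed.

(** This makes sums with different upper bounds comparable: they become sums
    over one and the same type of functions, with different conditions. *)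
Lemma multisum_widen (C : comNzRingType) (a : nat -> nat -> C) (q M P k : nat) :
  (M <= P)%N ->
  multisum a q M k =
  \sum_(N : {ffun 'I_k -> 'I_P.+1} |
          increasing_from q N && [forall i, (N i <= M)%N])
    \prod_(i < k) a i.+1 (N i).
Proof.
rewrite -ltnS => leMP.
pose widen (N : {ffun 'I_k -> 'I_M.+1}) := [ffun i => widen_ord leMP (N i)].
pose narrow (N : {ffun 'I_k -> 'I_P.+1}) : {ffun 'I_k -> 'I_M.+1} :=
  [ffun i => inord (N i)].
rewrite (reindex_onto widen narrow); last first.
  move=> N /andP[_ /forallP leNM]; apply/ffunP => i.
  by apply: val_inj; rewrite !ffunE /= inordK // ltnS.
apply: eq_big => [N|N _]; last by apply: eq_bigr => i _; rewrite ffunE.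
have -> : narrow (widen N) == N.
  by apply/eqP/ffunP => i; rewrite !ffunE /= inord_val.
have -> : [forall i, (widen N i <= M)%N].
  by apply/forallP => i; rewrite ffunE /= leq_ord.
rewrite !andbT; congr (_ && _).
  by apply: eq_forallb => i; rewrite ffunE.
by apply: eq_forallb => i; apply: eq_forallb => j; rewrite !ffunE.
Qed.

Definition extend_top (M k : nat) (N : {ffun 'I_k -> 'I_M.+1}) :
    {ffun 'I_k.+1 -> 'I_M.+1} :=
  [ffun i => oapp N ord_max (unlift ord_max i)].

Lemma extend_top_lift (M k : nat) (N : {ffun 'I_k -> 'I_M.+1}) (i : 'I_k) :
  extend_top N (lift ord_max i) = N i.
Proof. by rewrite ffunE liftK. Qed.

Lemma extend_top_last (M k : nat) (N : {ffun 'I_k -> 'I_M.+1}) :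
  extend_top N ord_max = ord_max.
Proof. by rewrite ffunE unlift_none. Qed.

Lemma increasing_from_extend_top (q M k : nat) (N : {ffun 'I_k -> 'I_M.+2}) :
  (q <= M.+1)%N ->
  increasing_from q (extend_top N) =
  increasing_from q N && [forall i, (N i <= M)%N].
Proof.
move=> leqM; apply/increasing_fromP/andP.
  case=> geq inc; split; last first.
    apply/forallP => i; have := inc (lift ord_max i) ord_max.
    by rewrite extend_top_lift extend_top_last lift_max => /(_ (ltn_ord i)).
  apply/increasing_fromP; split=> [i|i j lt_ij].
    by rewrite -extend_top_lift.
  have := inc (lift ord_max i) (lift ord_max j).
  by rewrite !extend_top_lift !lift_max; apply.
case=> /increasing_fromP[geq inc] /forallP leNM; split=> [i|i j].
  by case: (unliftP ord_max i) => [i'|] ->;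
    rewrite ?extend_top_lift ?extend_top_last.
case: (unliftP ord_max i) => [i'|] ->; case: (unliftP ord_max j) => [j'|] ->.
- by rewrite !extend_top_lift !lift_max; exact: inc.
- by rewrite extend_top_lift extend_top_last /= ltnS => _; exact: leNM.
- by rewrite lift_max ltnNge (ltnW (ltn_ord j')).
- by rewrite ltnn.
Qed.

(** The first summand collects the tuples whose last entry is at most M, hence
    all of whose entries are; in the second the last entry is M.+1, and the
    others form an arbitrary increasing tuple with entries at most M.  Such a
    last entry is admissible because q <= M.+1. *)
Lemma multisum_recr (C : comNzRingType) (a : nat -> nat -> C) (q M k : nat) :
  (q <= M.+1)%N ->
  multisum a q M.+1 k.+1 =
  multisum a q M k.+1 + a k.+1 M.+1 * multisum a q M k.
Proof.
move=> leqM; rewrite !(multisum_widen a q _ (leqnSn M)) /multisum.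
rewrite [LHS](bigID (fun N : {ffun 'I_k.+1 -> 'I_M.+2} => N ord_max <= M)%N) /=; congr (_ + _).
  apply: eq_bigl => N; apply: andb_id2l => incN.
  apply/idP/forallP => [leNM i|]; last exact.
  exact: leq_trans (increasing_from_le_last i incN) leNM.
pose restrict (N : {ffun 'I_k.+1 -> 'I_M.+2}) : {ffun 'I_k -> 'I_M.+2} :=
  [ffun i => N (lift ord_max i)].
rewrite (reindex_onto (@extend_top M.+1 k) restrict); last first.
  move=> N /andP[_]; rewrite -ltnNge => ltMN; apply/ffunP => i.
  case: (unliftP ord_max i) => [i'|] ->.
    by rewrite extend_top_lift ffunE.
  rewrite extend_top_last; apply: val_inj; apply/eqP.
  by rewrite eqn_leq ltMN leq_ord.
rewrite big_distrr; apply: eq_big => [N|N _] /=.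
  have -> : restrict (extend_top N) == N.
    by apply/eqP/ffunP => i; rewrite ffunE extend_top_lift.
  rewrite extend_top_last -ltnNge ltnSn !andbT.
  exact: increasing_from_extend_top.
rewrite big_ord_recr /= extend_top_last mulrC; congr (_ * _).
apply: eq_bigr => i _; rewrite -(extend_top_lift N i).
have -> // : lift ord_max i = widen_ord (leqnSn k) i.
by apply: val_inj; exact: lift_max.
Qed.

Lemma multisum_unroll (C : comNzRingType) (a : nat -> nat -> C) (m q n : nat) :
  (q + m - 1 <= n)%N ->
  multisum a q n.+1 m =
  \sum_(0 <= k < m.+1)
    (\prod_(0 <= j < m - k) a (m - j)%N (n.+1 - j)%N) *
    multisum a q (n + k - m)%N k.
Proof.
elim: m n => [|m IHm] n le_qmn.
  by rewrite big_nat1 !multisum0 subnn big_geq ?mulr1.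
have le_qm_n : (q + m <= n)%N by move: le_qmn; rewrite addnS subn1.
rewrite multisum_recr; last first.
  by rewrite leqW // (leq_trans _ le_qm_n) ?leq_addr.
rewrite big_nat_recr //= addrC subnn addnK (@big_geq _ _ _ 0 0) // mul1r.
congr (_ + _).
have -> : multisum a q n m =
    \sum_(0 <= k < m.+1)
      (\prod_(0 <= j < m - k) a (m - j)%N (n - j)%N) *
      multisum a q (n + k - m.+1)%N k.
  case: n {le_qmn} le_qm_n => [|n] le_qm_n.
    (* Only m = 0 is possible here, and n - 1 does not exist. *)
    have -> : m = 0%N.
      by apply/eqP; rewrite -leqn0 (leq_trans (leq_addl q m)).
    by rewrite big_nat1 !multisum0 subnn big_geq ?mulr1.
  rewrite IHm; last by rewrite leq_subLR add1n.
  by apply: eq_bigr => k _; rewrite addSn subSS.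
rewrite big_distrr; apply: eq_big_nat => k /andP[_ lekm] /=.
rewrite mulrA subSn // big_nat_recl // !subn0; congr (_ * _ * _).
Qed.

(* The bound n + k - m (for n - m + k) truncates only when k = 0 and
   n = m - 1; a multiple sum with k = 0 does not depend on its bounds. *)
Theorem theorem2p1 (R : realType) (m q n : nat) (a : nat -> nat -> R[i]) :
  (q + m - 1 <= n)%N ->
  multisum a q (n + 1)%N m =
  \sum_(0 <= k < m.+1)
    (\prod_(0 <= j < m - k) a (m - j)%N (n + 1 - j)%N) *
    multisum a q (n + k - m)%N k.
Proof. by move=> le_qmn; rewrite addn1; exact: multisum_unroll. Qed.
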